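(* Fix $q\in(0,1)$ and let $(\Gamma_n)_{n\ge 1}$ be any sequence of graphs with $|v(\Gamma_n)|\le n$. If the sequence of query budgets $Q_n$ satisfies $$Q_n=o\left(\frac{n^2}{|e(\Gamma_n)|}\right)\qquad (n\to\infty),$$ then weak detection is impossible with query budget $Q_n$.
   Context: Setup. $\Gamma_n$ is a finite simple undirected graph without isolated vertices and with at least one edge, with vertex set $v(\Gamma_n)$, edge set $e(\Gamma_n)$, and $|v(\Gamma_n)|\le n$. Under $\mathcal H_0$, $G$ is a random graph on $[n]=\{1,\dots,n\}$ in which each pair in $\binom{[n]}{2}$ is an edge independently with probability $q$. Under $\mathcal H_1$, a copy $\Gamma_n^\star$ is drawn uniformly from the set of all subgraphs of the complete graph on $[n]$ isomorphic to $\Gamma_n$; all edges of $\Gamma_n^\star$ are in $G$, and every other pair is an edge independently with probability $q$. For a query set $\mathcal Q\subseteq\binom{[n]}{2}$ (chosen non-adaptively), the transcript is $G_{\mathcal Q}=(\mathbf 1\{e\in e(G)\})_{e\in\mathcal Q}$, and $\mathbb P_{\mathcal H_0,\mathcal Q}$, $\mathbb P_{\mathcal H_1,\mathcal Q}$ are its laws under $\mathcal H_0,\mathcal H_1$. The optimal risk under budget $Q_n$ is $$R^\star_{n,Q_n}=1-\sup_{\mathcal Q\subseteq\binom{[n]}{2},\,|\mathcal Q|\le Q_n} d_{\mathrm{TV}}(\mathbb P_{\mathcal H_1,\mathcal Q},\mathbb P_{\mathcal H_0,\mathcal Q}).$$ Weak detection is impossible with query budget $Q_n$ if $\lim_{n\to\infty}R^\star_{n,Q_n}=1$.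 *)

(* Defs.v *)
From mathcomp Require Import all_boot all_order all_algebra.
From mathcomp Require Import all_classical all_reals all_analysis.

Set Implicit Arguments.
Unset Strict Implicit.
Unset Printing Implicit Defensive.

Import Order.TTheory GRing.Theory Num.Theory.
Import numFieldNormedType.Exports.

Local Open Scope ring_scope.

(* Unordered pairs of distinct elements of V; [upair 'I_n] is the index set of
   the possible edges of a graph on n labelled vertices. *)
Definition upair (V : finType) : finType := {e : {set V} | #|e| == 2%N}.

(* Edges are two-element sets, so loops and multiple edges cannot occur. *)
Record sgraph := SGraph { vert :> finType; edges : {set upair vert} }.

Definition no_isolated (G : sgraph) : Prop :=
  forall x : G, exists2 e : upair G, e \in edges G & x \in val e.

(* A subgraph of the complete graph on 'I_n is a pair (vertex set, edge set)
   whose edges have both endpoints in the vertex set. *)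
Definition is_subgraph (n : nat) (S : {set 'I_n} * {set upair 'I_n}) : bool :=
  [forall e in S.2, val e \subset S.1].

Definition is_isomorphism (G : sgraph) (n : nat)
    (S : {set 'I_n} * {set upair 'I_n}) (f : {ffun G -> 'I_n}) : bool :=
  [&& injectiveb f, f @: [set: G] == S.1 &
      [forall e : upair G,
        (e \in edges G) == [exists e' in S.2, val e' == f @: val e]]].

Definition copies (G : sgraph) (n : nat) :
    {set {set 'I_n} * {set upair 'I_n}} :=
  [set S | is_subgraph S && [exists f, is_isomorphism (G := G) S f]].

(* Probability mass function of the random edge set that contains each pair e
   independently with probability p e. *)
Definition indep_edges (R : realType) (n : nat) (p : upair 'I_n -> R)
    (G : {set upair 'I_n}) : R :=
  \prod_(e : upair 'I_n) (if e \in G then p e else 1 - p e).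

Definition null_model (R : realType) (q : R) (n : nat) :
    {set upair 'I_n} -> R :=
  indep_edges (fun=> q).

Definition planted_model (R : realType) (q : R) (Gam : sgraph) (n : nat)
    (G : {set upair 'I_n}) : R :=
  (\sum_(S in copies Gam n) indep_edges (fun e => if e \in S.2 then 1 else q) G)
    / #|copies Gam n|%:R.

Definition transcript (n : nat) (Q G : {set upair 'I_n}) :
    {ffun {e : upair 'I_n | e \in Q} -> bool} :=
  [ffun e => val e \in G].

Definition transcript_law (R : realType) (n : nat)
    (P : {set upair 'I_n} -> R) (Q : {set upair 'I_n})
    (t : {ffun {e : upair 'I_n | e \in Q} -> bool}) : R :=
  \sum_(G | transcript Q G == t) P G.

Definition dTV (R : realType) (T : finType) (P P' : T -> R) : R :=
  \big[Num.max/0]_(A : {set T}) `|\sum_(x in A) P x - \sum_(x in A) P' x|.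

Definition optimal_risk (R : realType) (q : R) (Gam : sgraph) (n b : nat) : R :=
  1 - sup [set dTV (transcript_law (planted_model q Gam (n:=n)) (Q:=Q))
                   (transcript_law (null_model q (n:=n)) (Q:=Q))
          | Q in [set Q : {set upair 'I_n} | (#|Q| <= b)%N]]%classic.

Definition weak_detection_impossible (R : realType) (q : R)
    (Gam : nat -> sgraph) (Q : nat -> nat) : Prop :=
  (optimal_risk q (Gam n) n (Q n) @[n --> \oo] --> (1 : R))%classic.

(* Main.v *)
(** If the planted edge set misses the query set, the transcript has the same
    law as under the null hypothesis, so the total variation distance is at most
    the probability that a uniform copy meets the query set.  By symmetry under
    permutations of the vertices each pair lies in a uniform copy with the same
    probability, |e(Gamma)| / 'C(n, 2); a union bound over the queries concludes. *)
Require Import Defs.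
From mathcomp Require Import all_boot all_order all_algebra fingroup perm.
From mathcomp Require Import all_classical all_reals all_analysis.
From mathcomp Require Import zify lra.

Import Order.TTheory GRing.Theory Num.Theory.
Import numFieldNormedType.Exports.

Local Open Scope ring_scope.

Lemma upair_map_subproof {V W : finType} {f : V -> W} (injf : injective f)
  (e : upair V) : #|f @: val e| == 2%N.
Proof. by rewrite (card_imset _ injf) (valP e). Qed.

Definition upair_map {V W : finType} {f : V -> W} (injf : injective f)
  (e : upair V) : upair W := exist _ (f @: val e) (upair_map_subproof injf e).

Lemma upair_map_inj {V W : finType} {f : V -> W} (injf : injective f) :
  injective (upair_map injf).
Proof. by move=> e e' /(congr1 val) /= /(imset_inj injf) /val_inj. Qed.

Lemma card_upair n : #|upair 'I_n| = 'C(n, 2).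
Proof. by rewrite card_sig -[in RHS](card_ord n) -card_draws cardsE. Qed.

Lemma is_isomorphismP (G : sgraph) n (S : {set 'I_n} * {set upair 'I_n})
    (f : {ffun G -> 'I_n}) :
  reflect [/\ injective f, f @: [set: G] = S.1 & forall e : upair G,
            (e \in edges G) = [exists e' in S.2, val e' == f @: val e]]
          (is_isomorphism (G := G) S f).
Proof.
apply: (iffP and3P) => [[/injectiveP injf /eqP fT /forallP fE]|[injf fT fE]].
  by split => // e; exact/eqP.
by split; [exact/injectiveP|exact/eqP|apply/forallP => e; exact/eqP].
Qed.

(** Numbering the vertices of [G] embeds it into ['I_n]. Hence the normalising division in
    [planted_model] is by a nonzero number. *)
Lemma copies_gt0 (G : sgraph) n : (#|G| <= n)%N -> (0 < #|copies G n|)%N.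
Proof.
move=> le_Gn; pose f := [ffun x : G => widen_ord le_Gn (enum_rank x)].
have injf : injective f.
  by move=> x y; rewrite !ffunE => /(congr1 val) /= /val_inj /enum_rank_inj.
apply/card_gt0P; exists (f @: [set: G], upair_map injf @: edges G).
rewrite inE; apply/andP; split.
  apply/'forall_implyP => e' /= /imsetP[e _ ->] /=.
  by apply: imsetS; exact: finset.subsetT.
apply/existsP; exists f; apply/is_isomorphismP; split => // e.
apply/idP/exists_inP => [Ge|[_ /imsetP[e' Ge' ->] /eqP eq_ee']] /=.
  by exists (upair_map injf e) => //=; exact: imset_f.
by rewrite (_ : e = e') //; apply/val_inj/(imset_inj injf).
Qed.

(** An edge of a copy lies inside the range of the isomorphism [f], so its preimage has again two
    elements and is an edge of [G]; every edge of the copy is thus the image of one of [G]. *)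
Lemma card_copy_edges (G : sgraph) n S :
  S \in copies G n -> (#|S.2| <= #|edges G|)%N.
Proof.
rewrite inE => /andP[/'forall_implyP subS /existsP[f /is_isomorphismP[injf fT fE]]].
rewrite -(card_imset _ (upair_map_inj injf)); apply/subset_leq_card/fintype.subsetP => e' Se'.
have /fintype.subsetP e'T := subS e' Se'.
have fe' : f @: (f @^-1: val e') = val e'.
  apply/finset.setP => y; apply/imsetP/idP => [[x]|ye']; first by rewrite inE => xe' ->.
  have : y \in f @: [set: G] by rewrite fT e'T.
  by case/imsetP => x _ eq_y; exists x => //; rewrite inE -eq_y.
have c2 : #|f @^-1: val e'| == 2%N by rewrite -(card_imset _ injf) fe' (valP e').
apply/imsetP; exists (exist (fun A : {set G} => #|A| == 2%N) _ c2).
  by rewrite fE; apply/exists_inP; exists e' => //=; rewrite fe'.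
by apply: val_inj; rewrite /= fe'.
Qed.

Definition perm_sub n (s : {perm 'I_n}) (S : {set 'I_n} * {set upair 'I_n}) :=
  (s @: S.1, upair_map (@perm_inj _ s) @: S.2).

Lemma perm_sub_inj n (s : {perm 'I_n}) : injective (perm_sub n s).
Proof.
move=> [A B] [A' B'] [/(imset_inj (@perm_inj _ s)) -> ].
by move=> /(imset_inj (upair_map_inj _)) ->.
Qed.

Lemma perm_sub_copies (G : sgraph) n (s : {perm 'I_n}) S :
  S \in copies G n -> perm_sub n s S \in copies G n.
Proof.
rewrite !inE => /andP[/'forall_implyP subS /existsP[f /is_isomorphismP[injf fT fE]]].
apply/andP; split.
  by apply/'forall_implyP => _ /imsetP[e Se ->]; exact/imsetS/subS.
apply/existsP; exists [ffun x => s (f x)].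
have sfE (A : {set G}) : [ffun x => s (f x)] @: A = s @: (f @: A).
  by rewrite -imset_comp; apply: eq_imset => x; rewrite ffunE.
apply/is_isomorphismP; split => [x y||e].
- by rewrite !ffunE => /perm_inj /injf.
- by rewrite sfE fT.
rewrite fE sfE; apply/exists_inP/exists_inP => [[e' Se' /eqP e'E]|].
  by exists (upair_map (@perm_inj _ s) e'); rewrite ?imset_f //= e'E.
case=> _ /imsetP[e' Se' ->] /eqP /= /(imset_inj (@perm_inj _ s)) e'E.
by exists e' => //; exact/eqP.
Qed.

Lemma perm_upair_trans n (e e' : upair 'I_n) :
  exists s : {perm 'I_n}, upair_map (@perm_inj _ s) e = e'.
Proof.
have [a [b [ab eE]]] := cards2P _ (valP e).
have [c [d [cd e'E]]] := cards2P _ (valP e').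
(* The first transposition sends a to c; the second sends the current image of b to d and fixes c,
   since c differs from d and from that image. *)
exists (tperm a c * tperm (tperm a c b) d)%g.
apply: val_inj; rewrite /= eE e'E imsetU1 imset_set1 !permM tpermL; congr (_ |: [set _]).
  rewrite tpermD // 1?eq_sym //.
  by rewrite -[X in X != _](tpermL a c) (inj_eq perm_inj).
by rewrite tpermL.
Qed.

Definition copies_at (G : sgraph) n (e : upair 'I_n) :=
  [set S in copies G n | e \in S.2].

(** A vertex permutation carrying [e] to [e'] injects the copies through [e] into those through
    [e']. As both pairs are arbitrary, the count is the same for all pairs. *)
Lemma card_copies_at_le (G : sgraph) n (e e' : upair 'I_n) :
  (#|copies_at G n e| <= #|copies_at G n e'|)%N.
Proof.
have [s <-] := perm_upair_trans n e e'.
rewrite -(card_imset _ (perm_sub_inj n s)); apply/subset_leq_card/fintype.subsetP.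
move=> S' /imsetP[S]; rewrite inE => /andP[CS eS] ->.
by rewrite inE perm_sub_copies //= imset_f.
Qed.

(** Double counting of the incidences between copies and their edges: summed by pairs, they give the
    left side by symmetry; summed by copies, they give at most the right side. *)
Lemma card_copies_at (G : sgraph) n (e : upair 'I_n) :
  (#|copies_at G n e| * 'C(n, 2) <= #|copies G n| * #|edges G|)%N.
Proof.
apply: (@leq_trans (\sum_(e' : upair 'I_n) #|copies_at G n e'|)%N).
  rewrite -card_upair mulnC -sum_nat_const.
  by apply: leq_sum => e' _; exact: card_copies_at_le.
have -> : (\sum_(e' : upair 'I_n) #|copies_at G n e'| =
           \sum_(S in copies G n) #|S.2|)%N.
  rewrite (eq_bigr (fun e' => \sum_(S in copies G n) (e' \in S.2 : nat))%N).
    rewrite exchange_big; apply: eq_bigr => S _; rewrite -sum1_card [RHS]big_mkcond.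
    by apply: eq_bigr => e' _; case: (e' \in _).
  move=> e' _; rewrite -sum1_card big_mkcond [RHS]big_mkcond.
  by apply: eq_bigr => S _; rewrite inE; case: (S \in _); case: (e' \in _).
by rewrite -sum_nat_const; apply: leq_sum => S; exact: card_copy_edges.
Qed.

Lemma indep_edges_ge0 (R : realType) n (p : upair 'I_n -> R) (G : {set upair 'I_n}) :
  (forall e, 0 <= p e <= 1) -> 0 <= indep_edges p G.
Proof.
move=> p01; apply: prodr_ge0 => e _; have /andP[p0 p1] := p01 e.
by case: ifP; rewrite ?subr_ge0.
Qed.

Lemma transcript_eqP n (Q G G' : {set upair 'I_n}) :
  reflect {in Q, G =i G'} (transcript Q G == transcript Q G').
Proof.
apply: (iffP eqP) => [/ffunP eqT e Qe|eqG].
  by have := eqT (exist _ e Qe); rewrite !ffunE.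
by apply/ffunP => -[e Qe]; rewrite !ffunE /= eqG.
Qed.

Lemma transcript_surj n (Q : {set upair 'I_n}) t : exists G, transcript Q G = t.
Proof.
(* The transcript is extended by non-edges outside [Q]. *)
exists [set e | if insub e is Some u then t u else false].
apply/ffunP => u; rewrite ffunE inE; case: insubP => [v _ /val_inj -> //|].
by rewrite (valP u).
Qed.

(** The law of a transcript sees [p] only on [Q], which is what makes a copy missing [Q]
    undetectable. Agreement with [G0] on [Q] is encoded by setting to zero the factor of each
    disagreeing choice; the sum over all [G] then factorises, and each pair outside [Q] contributes
    p + (1 - p) = 1. *)
Lemma transcript_law_indep (R : realType) n (p : upair 'I_n -> R)
    (Q G0 : {set upair 'I_n}) :
  transcript_law (indep_edges p) (transcript Q G0) =
  \prod_(e in Q) (if e \in G0 then p e else 1 - p e).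
Proof.
pose F e := if (e \in Q) && (e \notin G0) then 0 else p e.
pose H e := if (e \in Q) && (e \in G0) then 0 else 1 - p e.
transitivity (\sum_(G : {set upair 'I_n}) \prod_e (if e \in G then F e else H e)).
  rewrite /transcript_law big_mkcond; apply: eq_bigr => G _.
  case: transcript_eqP => [eqG|neqG].
    apply: eq_bigr => e _; rewrite /F /H.
    case: (boolP (e \in Q)) => //= /eqG <-.
    by case: (e \in G).
  have [e Qe] : exists2 e, e \in Q & (e \in G) != (e \in G0).
    apply/exists_inP; apply: contra_notT neqG => /exists_inPn eqG e Qe.
    by apply/eqP; rewrite -[_ == _]negbK; exact: eqG.
  rewrite (bigD1 e) //= /F /H Qe.
  by case: (e \in G); case: (e \in G0); rewrite //= mul0r.
rewrite -bigA_distr [RHS]big_mkcond; apply: eq_bigr => e _; rewrite /F /H.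
by case: (e \in Q); case: (e \in G0); rewrite /= ?addr0 ?add0r // addrC subrK.
Qed.

Lemma sum_transcript_law (R : realType) n (p : upair 'I_n -> R)
    (Q : {set upair 'I_n}) :
  \sum_t transcript_law (indep_edges p) (Q := Q) t = 1.
Proof.
transitivity (\sum_G indep_edges p G).
  by rewrite [RHS](partition_big (transcript Q) predT).
by rewrite -bigA_distr big1 // => e _ /=; rewrite addrC subrK.
Qed.

Lemma sum_transcript_law_itv (R : realType) n (p : upair 'I_n -> R)
    (Q : {set upair 'I_n}) (A : {set {ffun {e | e \in Q} -> bool}}) :
  (forall e, 0 <= p e <= 1) ->
  0 <= \sum_(t in A) transcript_law (indep_edges p) t <= 1.
Proof.
move=> p01; have law_ge0 t : 0 <= transcript_law (indep_edges p) (Q := Q) t.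
  by apply: sumr_ge0 => G _; exact: indep_edges_ge0.
rewrite sumr_ge0 //= -(sum_transcript_law _ _ p Q).
by rewrite [leRHS](bigID (mem A)) /= lerDl sumr_ge0.
Qed.

(** The planted law is the average over copies of independent-edge laws. On any event, a copy's law
    differs from the null law by 0 if the copy misses [Q] and by at most 1 otherwise, so by at most
    the number of its edges in [Q]. *)
Lemma dTV_planted_le (R : realType) (q : R) (G : sgraph) n (Q : {set upair 'I_n}) :
  0 < q -> q < 1 -> (2 <= n)%N -> (#|G| <= n)%N ->
  dTV (transcript_law (planted_model q G (n := n)) (Q := Q))
      (transcript_law (null_model q (n := n)) (Q := Q))
  <= #|Q|%:R * (#|edges G|%:R / 'C(n, 2)%:R).
Proof.
move=> q0 q1 n2 le_Gn.
have C0 : 0 < #|copies G n|%:R :> R by rewrite ltr0n copies_gt0.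
have B0 : 0 < 'C(n, 2)%:R :> R by rewrite ltr0n bin_gt0.
(* The union bound: exchanging the sums over copies and queries leaves, for each query, the number
   of copies through it, which [card_copies_at] controls. *)
have bnd : (\sum_(S in copies G n) #|S.2 :&: Q|)%N%:R <=
    #|copies G n|%:R * (#|Q|%:R * (#|edges G|%:R / 'C(n, 2)%:R)) :> R.
  rewrite (eq_bigr (fun S : {set 'I_n} * {set upair 'I_n} =>
      \sum_(e in Q) (e \in S.2 : nat))%N); last first.
    move=> S _; rewrite -sum1_card big_mkcond [RHS]big_mkcond.
    by apply: eq_bigr => e _; rewrite inE; case: (e \in S.2); case: (e \in Q).
  rewrite exchange_big /= natr_sum mulrCA [leRHS]mulr_natl -[leRHS]sumr_const.
  apply: ler_sum => e _; rewrite mulrA ler_pdivlMr // -!natrM ler_nat.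
  apply: leq_trans (card_copies_at G n e); rewrite leq_mul2r -sum1_card.
  rewrite big_mkcond [leqRHS]big_mkcond; apply/orP; right; apply: leq_sum => S _.
  by rewrite [S \in copies_at _ _ _]inE; case: (S \in _); case: (e \in _).
(* The maximum starts from 0, so the bound itself must be shown nonnegative. *)
rewrite /dTV; apply: (big_ind (fun x => x <= _)) => [|x y xle yle|A _]; first by rewrite !mulr_ge0 ?invr_ge0.
  by rewrite ge_max xle.
pose pS S e : R := if e \in (S : {set 'I_n} * {set upair 'I_n}).2 then 1 else q.
pose m (p : upair 'I_n -> R) := \sum_(t in A) transcript_law (indep_edges p) t.
have -> : \sum_(t in A) transcript_law (planted_model q G (n := n)) t =
    (\sum_(S in copies G n) m (pS S)) / #|copies G n|%:R.
  rewrite /m exchange_big /= mulr_suml; apply: eq_bigr => t _.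
  by rewrite /transcript_law exchange_big /= mulr_suml.
(* The null probability is written as an average of constants over the copies, so that the
   difference can be estimated copy by copy. *)
rewrite -/(m (fun=> q)) -[X in _ - X](mulfK (lt0r_neq0 C0)).
rewrite -mulrBl mulr_natr -sumr_const -sumrB normrM normfV [`|_%:R|]ger0_norm //.
rewrite ler_pdivrMr // [leRHS]mulrC; apply: le_trans bnd; rewrite natr_sum.
apply: le_trans (ler_norm_sum _ _ _) _; apply: ler_sum => S _.
have [SQ0|] := posnP #|S.2 :&: Q|.
  rewrite SQ0 /m -sumrB big1 ?normr0 // => t _; have [G0 <-] := transcript_surj _ _ t.
  rewrite !transcript_law_indep; apply/eqP; rewrite subr_eq0; apply/eqP.
  apply: eq_bigr => e Qe; rewrite /pS (_ : e \in S.2 = false) //.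
  by move/cards0_eq/finset.setP/(_ e): SQ0; rewrite !inE Qe andbT.
rewrite -(ler_nat R) => le1; apply: le_trans le1.
have q01 : 0 <= q <= 1 by rewrite !ltW.
have /andP[? ?] : 0 <= m (pS S) <= 1.
  by apply: sum_transcript_law_itv => e; rewrite /pS; case: ifP; rewrite ?ler01 ?lexx.
have /andP[? ?] : 0 <= m (fun=> q) <= 1 by exact: sum_transcript_law_itv.
rewrite ler_norml; lra.
Qed.

Lemma optimal_risk_itv (R : realType) (q : R) (G : sgraph) n b :
  0 < q -> q < 1 -> (2 <= n)%N -> (#|G| <= n)%N ->
  1 - b%:R * (#|edges G|%:R / 'C(n, 2)%:R) <= optimal_risk q G n b <= 1.
Proof.
move=> q0 q1 n2 le_Gn; rewrite /optimal_risk lerD2l lerN2 gerBl.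
set D := (X in sup X); set B := _ * _.
(* The empty query set respects every budget, so the supremum is over a nonempty set; with the bound
   [DB], it is a genuine least upper bound. *)
have D0 : D (dTV (transcript_law (planted_model q G (n := n)) (Q := finset.set0))
      (transcript_law (null_model q (n := n)) (Q := finset.set0))).
  by exists finset.set0 => //=; rewrite cards0.
have DB : ubound D B.
  move=> _ [Q /= Qb <-]; apply: le_trans (dTV_planted_le _ _ _ _ _ q0 q1 n2 le_Gn) _.
  by rewrite ler_wpM2r ?divr_ge0 // ler_nat.
apply/andP; split; first by apply: ge_sup => //; eexists; exact: D0.
apply: le_trans (ub_le_sup _ D0); last by exists B.
by rewrite /dTV; apply: (big_ind (fun x => 0 <= x)) => // x y x0 y0; rewrite le_max x0.
Qed.

Local Open Scope classical_set_scope.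

(* No graph with an edge has at most one vertex, so the conditions on the
   graphs are imposed from n = 2 on. *)
Theorem theorem1 (R : realType) (q : R) (hq0 : 0 < q) (hq1 : q < 1)
    (Gam : nat -> sgraph) (Q : nat -> nat)
    (hiso : forall n, (2 <= n)%N -> no_isolated (Gam n))
    (hedge : forall n, (2 <= n)%N -> (0 < #|edges (Gam n)|)%N)
    (hsize : forall n, (2 <= n)%N -> (#|Gam n| <= n)%N)
    (hQ : (fun n => (Q n)%:R : R) =o_\oo
          (fun n => n%:R ^+ 2 / #|edges (Gam n)|%:R : R)) :
  weak_detection_impossible q Gam Q.
Proof.
have /eqoP hQ0 := hQ.
apply/cvgrPdist_le => eps eps0; near=> n.
have n2 : (2 <= n)%N by near: n; exact: nbhs_infty_ge.
have E0 : 0 < #|edges (Gam n)|%:R :> R by rewrite ltr0n hedge.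
(* The little-o hypothesis is used with constant eps / 4, the 4 being the one lost in [B4]. *)
have QE : (Q n)%:R * #|edges (Gam n)|%:R <= eps / 4 * n%:R ^+ 2.
  rewrite -ler_pdivlMr // -[leRHS]mulrA -[leLHS]ger0_norm //.
  rewrite -[X in _ * X]ger0_norm ?divr_ge0 ?exprn_ge0 //.
  by near: n; apply: hQ0; rewrite divr_gt0.
have /andP[] := optimal_risk_itv _ _ _ _ (Q n) hq0 hq1 n2 (hsize n n2).
(* Since 2 * 'C(n, 2) = n * (n - 1), this amounts to n <= 2 * (n - 1), true from n = 2 on. *)
have B4 : n%:R ^+ 2 <= 4 * 'C(n, 2)%:R :> R.
  rewrite -natrX -natrM ler_nat.
  by rewrite (_ : 4 = 2 * 2)%N // -mulnA -[X in (2 * X)%N]mul_bin_diag bin1; nia.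
have B0 : 0 < 'C(n, 2)%:R :> R by rewrite ltr0n bin_gt0.
have : (Q n)%:R * (#|edges (Gam n)|%:R / 'C(n, 2)%:R) <= eps.
  by rewrite mulrA ler_pdivrMr //; nra.
by rewrite ler_norml; lra.
Unshelve. all: by end_near. Qed.
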